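(* Let $\tau\in\mathbb{C}\setminus\{0\}$, $\lambda\ge 1$, $0\le\delta\le 1$, and let $\varphi(z)=1+B_1z+B_2z^2+\cdots$ be a function as described in the context. Let $n\ge 4$ be an integer, and let $f(z)=z+\sum_{k=2}^{\infty}a_kz^k$ belong to the class $\mathcal{H}_{\Sigma}(\tau,\lambda,\delta;\varphi)$ with $a_k=0$ for all $2\le k\le n-1$. Then $$|a_n|\le\frac{B_1|\tau|}{1+(n-1)(\lambda+n\delta)}.$$
   Context: $U=\{z\in\mathbb{C}:|z|<1\}$. $\Sigma$ denotes the class of bi-univalent functions in $U$: analytic functions $f(z)=z+\sum_{k\ge2}a_kz^k$ that are univalent in $U$ and whose inverse $g=f^{-1}$ (defined near $0$) is also univalent in $U$, i.e. extends to a univalent analytic function on $U$. For analytic functions $F,G$ on $U$, $F\prec G$ (subordination) means $F=G\circ\omega$ for some analytic $\omega:U\to U$ with $\omega(0)=0$. The function $\varphi$ is analytic in $U$ with positive real part, $\varphi(0)=1$, $\varphi'(0)>0$, $\varphi(U)$ symmetric with respect to the real axis, and expansion $\varphi(z)=1+B_1z+B_2z^2+B_3z^3+\cdots$ with $B_1>0$ and all $B_n\in\mathbb{R}$. For $\lambda\ge1$, $\tau\in\mathbb{C}\setminus\{0\}$, $0\le\delta\le1$, a function $f\in\Sigma$ with inverse $g=f^{-1}$ is in the class $\mathcal{H}_{\Sigma}(\tau,\lambda,\delta;\varphi)$ if, for $z,w\in U$, $$1+\frac1\tau\left((1-\lambda)\frac{f(z)}{z}+\lambda f'(z)+\delta zf''(z)-1\right)\prec\varphi(z)$$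 and $$1+\frac1\tau\left((1-\lambda)\frac{g(w)}{w}+\lambda g'(w)+\delta wg''(w)-1\right)\prec\varphi(w).$$ *)

(* Defs.v *)
From Stdlib Require Import Reals.
From Coquelicot Require Import Coquelicot.

Open Scope R_scope.

Definition in_disc (z : C) : Prop := Cmod z < 1.

(* Analyticity in the sense of power series: near each point of the disc the
   function is the sum of a convergent power series centred at that point. *)
Definition analytic_at (f : C -> C) (z0 : C) : Prop :=
  exists (c : nat -> C) (r : R), 0 < r /\
    forall z : C, Cmod (z - z0)%C < r ->
      @is_pseries C_AbsRing C_NormedModule c (z - z0)%C (f z).

Definition analytic (f : C -> C) : Prop :=
  forall z : C, in_disc z -> analytic_at f z.

Definition univalent (f : C -> C) : Prop :=
  analytic f /\
  forall z1 z2 : C, in_disc z1 -> in_disc z2 -> f z1 = f z2 -> z1 = z2.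

Definition expansion (f : C -> C) (a : nat -> C) : Prop :=
  forall z : C, in_disc z -> @is_pseries C_AbsRing C_NormedModule a z (f z).

(* f(z) = z + a_2 z^2 + a_3 z^3 + ... on the disc. *)
Definition normalized_expansion (f : C -> C) (a : nat -> C) : Prop :=
  a 0%nat = RtoC 0 /\ a 1%nat = RtoC 1 /\ expansion f a.

(* Functions are total, so g is the extension to the disc of the inverse of f:
   it is analytic and injective on the disc, and near 0 it sends w to a point
   of the disc whose image under f is w.  When f is injective on the disc,
   that point is f^{-1}(w). *)
Definition univalent_inverse (f g : C -> C) : Prop :=
  univalent g /\
  exists rho : R, 0 < rho /\
    forall w : C, Cmod w < rho -> in_disc (g w) /\ f (g w) = w.

Definition bi_univalent (f : C -> C) : Prop :=
  univalent f /\
  (exists a : nat -> C, normalized_expansion f a) /\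
  (exists g : C -> C, univalent_inverse f g).

Definition subordinate (F G : C -> C) : Prop :=
  exists omega : C -> C,
    analytic omega /\
    (forall z : C, in_disc z -> in_disc (omega z)) /\
    omega (RtoC 0) = RtoC 0 /\
    (forall z : C, in_disc z -> F z = G (omega z)).

Definition admissible_phi (phi : C -> C) (B : nat -> R) : Prop :=
  analytic phi /\
  (forall z : C, in_disc z -> 0 < Re (phi z)) /\
  phi (RtoC 0) = RtoC 1 /\
  (Im (C_derive phi (RtoC 0)) = 0 /\ 0 < Re (C_derive phi (RtoC 0))) /\
  (forall z : C, in_disc z ->
     exists z' : C, in_disc z' /\ phi z' = Cconj (phi z)) /\
  expansion phi (fun k : nat => RtoC (B k)) /\
  B 0%nat = 1 /\
  0 < B 1%nat.

(* f(z)/z, with its removable singularity at 0 filled in (for f(0) = 0). *)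
Definition div_id (f : C -> C) (z : C) : C :=
  if Ceq_dec z (RtoC 0) then C_derive f (RtoC 0) else (f z / z)%C.

Definition H_expr (tau : C) (lambda delta : R) (f : C -> C) (z : C) : C :=
  (1 + / tau * ((1 - lambda) * div_id f z + lambda * C_derive f z
                + delta * z * C_derive (C_derive f) z - 1))%C.

Definition class_H (tau : C) (lambda delta : R) (phi f : C -> C) : Prop :=
  bi_univalent f /\
  exists g : C -> C, univalent_inverse f g /\
    subordinate (H_expr tau lambda delta f) phi /\
    subordinate (H_expr tau lambda delta g) phi.

(* Main.v *)
Require Import Defs.
From Stdlib Require Import Reals.
From Coquelicot Require Import Coquelicot.
From Stdlib Require Wf_nat.
From Stdlib Require Import Lra Lia Classical ClassicalEpsilon List.

(** Put m = n - 1 and let F be the left-hand side of the subordination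
    condition on f.  Since a_2, ..., a_m vanish, differentiating the power
    series of f term by term gives
      F(z) = 1 + D z^m + O(z^(m+1)),   D = (1 + m (lambda + n delta)) a_n / tau.
    Subordination writes F = phi o omega with omega mapping the disc to itself
    and fixing 0.  As phi(w) = 1 + B_1 w + O(w^2) with B_1 > 0, comparing the
    two expansions near 0 forces omega(z) = p z^m + O(z^(m+1)) with p = D / B_1
    (leading_term_of_comp).  The bound on a_n is then |p| <= 1, a form of the
    Schwarz lemma (Schwarz_leading_coefficient).

    To prove |p| <= 1, let h(z) = omega(z) / z^m, with h(0) = p.  If |h|
    is at most r^(-m) on each closed disc |z| <= r < 1, then letting r tend to 1
    gives the claim.  On the circle |z| = r the bound is clear, so what is needed
    is that |h| has its maximum over the closed disc on the circle.  Among the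
    points where the maximum is attained take one, z0, farthest from the origin.
    If z0 were interior and h(z0) nonzero, then by
    monomial_quotient_max_modulus either |h| >= |h(z0)| on a neighbourhood of
    z0, which contains maximum points farther out, or |h| > |h(z0)| somewhere
    in the disc; both are impossible.  If h(z0) = 0, then h vanishes on the
    disc and p = h(0) = 0.

    The local behaviour of h at z0 is read off from the power series of
    omega(z) - h(z0) z^m at z0, which avoids dividing power series.  For z0 different from 0 its first nonzero
    term c (z - z0)^k can be given the direction of h(z0) z0^m by choosing a
    k-th root of a unit complex number, and then |omega(z)| exceeds
    |h(z0)| |z|^m (exceeds_nearby).  For z0 = 0 the same is done after that
    difference and its first nonzero term are divided by z^m. *)

(** * Complex series and power series *)

Notation Cseries := (@is_series C_AbsRing C_NormedModule).
Notation Cpseries := (@is_pseries C_AbsRing C_NormedModule).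

Lemma pow_n_Cpow (z : C) (k : nat) : @pow_n C_AbsRing z k = (z ^ k)%C.
Proof. induction k as [|k IH]; [reflexivity|]. simpl. rewrite IH. reflexivity. Qed.

Lemma Cpseries_Cseries (c : nat -> C) (u l : C) :
  Cpseries c u l <-> Cseries (fun k => c k * u ^ k)%C l.
Proof.
  assert (H : forall k, @scal C_AbsRing C_NormedModule (@pow_n C_AbsRing u k) (c k)
                        = (c k * u ^ k)%C).
  { intro k. rewrite <- (pow_n_Cpow u k). apply Cmult_comm. }
  split; apply is_series_ext; intro k; [|symmetry]; apply H.
Qed.

Lemma Cseries_Cmod_le (t : nat -> C) (l : C) (b : nat -> R) (s : R) :
  Cseries t l -> is_series b s -> (forall k, Cmod (t k) <= b k) -> Cmod l <= s.
Proof.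
  intros Ht Hb Hle.
  assert (Hn : filterlim (fun n => norm (sum_n t n)) eventually (locally (norm l))).
  { eapply filterlim_comp; [exact Ht | apply filterlim_norm]. }
  change (Rle (@norm C_AbsRing C_NormedModule l) s).
  enough (H : Rbar_le (Finite (norm l)) (Finite s)) by exact H.
  refine (is_lim_seq_le (fun n => norm (sum_n t n)) (sum_n b) (norm l) s _ Hn Hb).
  intro n. unfold sum_n. eapply Rle_trans; [apply (norm_sum_n_m (K := C_AbsRing) (V := C_NormedModule))|].
  apply sum_n_m_le. intro k. apply Hle.
Qed.

(** Past some index all partial sums are within 1 of the limit, so consecutive
    ones differ by less than 2. *)
Lemma Cseries_bounded (t : nat -> C) (l : C) :
  Cseries t l -> exists K, 0 < K /\ forall k, Cmod (t k) <= K.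
Proof.
  intro Ht.
  assert (H0 := proj1 (filterlim_locally_ball_norm (sum_n t) l) Ht (mkposreal 1 Rlt_0_1)).
  destruct H0 as [N HN]. simpl in HN.
  assert (Hfin : forall N, exists K, 0 < K /\ forall k, (k <= N)%nat -> Cmod (t k) <= K).
  { induction N0 as [|N0 [K [HK HKb]]].
    - exists (Cmod (t 0%nat) + 1). split; [pose proof (Cmod_ge_0 (t 0%nat)); lra|].
      intros k Hk. replace k with 0%nat by lia. lra.
    - exists (K + Cmod (t (S N0))). pose proof (Cmod_ge_0 (t (S N0))).
      split; [lra|]. intros k Hk.
      destruct (Nat.eq_dec k (S N0)) as [->|]; [lra|].
      assert (Cmod (t k) <= K) by (apply HKb; lia). lra. }
  destruct (Hfin (S N)) as [K [HK HKb]].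
  exists (K + 2). split; [lra|]. intro k.
  destruct (Nat.le_gt_cases k (S N)) as [Hk|Hk].
  { specialize (HKb k Hk). lra. }
  destruct k as [|k]; [lia|].
  assert (H1 := HN k ltac:(lia)). assert (H2 := HN (S k) ltac:(lia)).
  unfold ball_norm in H1, H2. 
  rewrite sum_Sn in H2.
  change (Cmod (sum_n t k - l)%C < 1) in H1.
  change (Cmod (sum_n t k + t (S k) - l)%C < 1) in H2.
  replace (t (S k)) with ((sum_n t k + t (S k) - l) + - (sum_n t k - l))%C by ring.
  eapply Rle_trans; [apply Cmod_triangle|]. rewrite Cmod_opp. lra.
Qed.

(** The terms are bounded at the point r / 2, so those of index above k are
    dominated on |u| < r / 4 by a geometric series of ratio at most 1 / 2. *)
Lemma Cpseries_remainder (f : C -> C) (c : nat -> C) (r : R) (k : nat) :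
  0 < r -> (1 <= k)%nat ->
  (forall u, Cmod u < r -> Cpseries c u (f u)) ->
  (forall j, (0 < j < k)%nat -> c j = 0) ->
  exists M rho, 0 < M /\ 0 < rho /\ forall u, Cmod u < rho ->
    Cmod (f u - c 0%nat - c k * u ^ k)%C <= M * Cmod u ^ S k.
Proof.
  intros Hr Hk Hf Hc.
  set (s := r / 2). assert (Hs : 0 < s) by (unfold s; lra).
  assert (Hsr : Cmod (RtoC s) < r).
  { rewrite Cmod_R, Rabs_pos_eq by lra. unfold s; lra. }
  assert (H1 := proj1 (Cpseries_Cseries _ _ _) (Hf _ Hsr)).
  destruct (Cseries_bounded _ _ H1) as [K [HK HKb]].
  assert (Hcb : forall j, Cmod (c j) * s ^ j <= K).
  { intro j. specialize (HKb j). rewrite Cmod_mult, Cmod_pow, Cmod_R, Rabs_pos_eq in HKb by lra.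
    exact HKb. }
  exists (2 * K / s ^ S k), (s / 2).
  assert (Hspow : 0 < s ^ S k) by (apply pow_lt; lra).
  split; [|split; [lra|]].
  { apply Rdiv_lt_0_compat; lra. }
  intros u Hu.
  assert (Hur : Cmod u < r) by (unfold s in Hu; lra).
  assert (H2 := proj1 (Cpseries_Cseries _ _ _) (Hf _ Hur)).
  set (t := fun j => (c j * u ^ j)%C) in *.
  assert (Hsum : sum_n t k = (c 0%nat + c k * u ^ k)%C).
  { destruct k as [|k]; [lia|]. rewrite sum_Sn.
    assert (Hz : forall j, (j <= k)%nat -> sum_n t j = c 0%nat).
    { induction j as [|j IH]; intro Hj.
      - rewrite sum_O. unfold t. simpl. ring.
      - rewrite sum_Sn, IH by lia. unfold t. rewrite (Hc (S j)) by lia.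
        change (c 0%nat + 0 * u ^ S j = c 0%nat)%C. ring. }
    rewrite Hz by lia. reflexivity. }
  assert (H3 : Cseries (fun j => t (S k + j)%nat) (f u - c 0%nat - c k * u ^ k)%C).
  { apply is_series_incr_n; [lia|]. 
    match goal with |- is_series _ ?x => replace x with (f u); [exact H2|] end.
    transitivity (f u - c 0%nat - c k * u ^ k + sum_n t k)%C; [|reflexivity].
    rewrite Hsum. ring. }
  set (q := Cmod u / s).
  assert (Hq0 : 0 <= q).
  { unfold q. apply Rdiv_le_0_compat; [apply Cmod_ge_0|lra]. }
  assert (Hq1 : q <= / 2).
  { unfold q. apply Rmult_le_reg_r with s; [lra|]. unfold Rdiv.
    rewrite Rmult_assoc, Rinv_l by lra. unfold s in *; lra. }
  assert (Hgeo : is_series (fun j => K * q ^ S k * q ^ j) (K * q ^ S k * / (1 - q))).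
  { apply (is_series_scal (K := R_AbsRing) (V := R_NormedModule)). apply is_series_geom. rewrite Rabs_pos_eq by lra. lra. }
  assert (HqS : 0 <= q ^ S k) by (apply pow_le; lra).
  eapply Rle_trans.
  - apply (Cseries_Cmod_le _ _ _ _ H3 Hgeo).
    intro j. unfold t. rewrite Cmod_mult, Cmod_pow.
    rewrite Rmult_assoc, <- pow_add.
    replace (Cmod u) with (q * s) by (unfold q; field; lra).
    rewrite Rpow_mult_distr.
    assert (0 <= q ^ (S k + j)) by (apply pow_le; lra).
    specialize (Hcb (S k + j)%nat). nra.
  - assert (Hinv : / (1 - q) <= 2).
    { rewrite <- (Rinv_inv 2). apply Rinv_le_contravar; lra. }
    replace (2 * K / s ^ S k * Cmod u ^ S k) with (K * q ^ S k * 2).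
    + apply Rmult_le_compat_l; [|exact Hinv]. apply Rmult_le_pos; lra.
    + unfold q. unfold Rdiv. rewrite Rpow_mult_distr, pow_inv. ring.
Qed.

Lemma Cseries_head (x : C) :
  Cseries (fun k => match k with O => x | S _ => RtoC 0 end) x.
Proof.
  apply filterlim_ext with (fun _ : nat => x); [|apply filterlim_const].
  intro n. symmetry. induction n as [|n IH]; [apply sum_O|].
  rewrite sum_Sn, IH. apply Cplus_0_r.
Qed.

Lemma Cpseries_constant (c : nat -> C) (u l : C) :
  (forall k, (1 <= k)%nat -> c k = RtoC 0) -> Cpseries c u l -> l = c 0%nat.
Proof.
  intros Hc Hl. apply Cpseries_Cseries in Hl.
  apply (filterlim_locally_unique (K := C_AbsRing) (V := C_NormedModule) _ _ _ Hl).
  apply (is_series_ext (K := C_AbsRing) (V := C_NormedModule)) with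
    (fun k => match k with O => c 0%nat | S _ => RtoC 0 end); [|apply Cseries_head].
  intros [|k].
  - change (c 0%nat = c 0%nat * 1)%C. ring.
  - change (RtoC 0 = c (S k) * u ^ S k)%C. rewrite Hc by lia. ring.
Qed.

(** * Termwise differentiation *)

Lemma expansion_CV_radius (f : C -> C) (a : nat -> C) (x : R) :
  expansion f a -> 0 <= x < 1 -> Rbar_lt (Rabs x) (CV_radius (fun k => Cmod (a k))).
Proof.
  intros Hf Hx.
  set (s := (x + 1) / 2).
  assert (Hs : in_disc (RtoC s)).
  { unfold in_disc. rewrite Cmod_R, Rabs_pos_eq; unfold s; lra. }
  destruct (Cseries_bounded _ _ (proj1 (Cpseries_Cseries _ _ _) (Hf _ Hs))) as [K [HK HKb]].
  destruct (CV_radius_bounded (fun k => Cmod (a k))) as [Hub _].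
  apply Rbar_lt_le_trans with (Finite s).
  - simpl. rewrite Rabs_pos_eq; unfold s; lra.
  - apply Hub. exists K. intro k. specialize (HKb k).
    rewrite Cmod_mult, Cmod_pow, Cmod_R in HKb.
    rewrite Rabs_mult, <- RPow_abs, (Rabs_pos_eq (Cmod _)) by apply Cmod_ge_0.
    exact HKb.
Qed.

(** Second-order remainder of the power function.  The factors on the right are
    those of the second derived power series, whose convergence makes the
    bound summable over k. *)
Lemma Cpow_diff_remainder (z h : C) (x : R) (k : nat) :
  Cmod z <= x -> Cmod (z + h)%C <= x ->
  Cmod ((z + h) ^ S (S k) - z ^ S (S k) - RtoC (INR (S (S k))) * z ^ S k * h)%C
  <= INR (S (S k)) * INR (S k) * x ^ k * Cmod h ^ 2.
Proof.
  intros Hz Hzh.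
  assert (Hx : 0 <= x) by (pose proof (Cmod_ge_0 z); lra).
  induction k as [|k IH].
  - replace ((z + h) ^ 2 - z ^ 2 - RtoC (INR 2) * z ^ 1 * h)%C with (h ^ 2)%C.
    + rewrite Cmod_pow. simpl. pose proof (pow2_ge_0 (Cmod h)). simpl in H. lra.
    + simpl INR. simpl. rewrite RtoC_plus. ring.
  - set (E := ((z + h) ^ S (S k) - z ^ S (S k) - RtoC (INR (S (S k))) * z ^ S k * h)%C) in *.
    replace ((z + h) ^ S (S (S k)) - z ^ S (S (S k)) - RtoC (INR (S (S (S k)))) * z ^ S (S k) * h)%C
      with ((z + h) * E + RtoC (INR (S (S k))) * z ^ S k * h ^ 2)%C.
    + eapply Rle_trans; [apply Cmod_triangle|].
      rewrite !Cmod_mult, !Cmod_pow, Cmod_R, Rabs_pos_eq by apply pos_INR.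
      assert (Hh := pow2_ge_0 (Cmod h)).
      assert (Hxk : 0 <= x ^ k) by (apply pow_le; lra).
      assert (Hzk : Cmod z ^ S k <= x ^ S k) by (apply pow_incr; split; [apply Cmod_ge_0|lra]).
      assert (HE : Cmod (z + h)%C * Cmod E <= x * (INR (S (S k)) * INR (S k) * x ^ k * Cmod h ^ 2))
        by (apply Rmult_le_compat; auto using Cmod_ge_0).
      assert (Hn : 0 <= INR (S (S k))) by apply pos_INR.
      assert (H2 : INR (S (S k)) * Cmod z ^ S k * Cmod h ^ 2 <= INR (S (S k)) * x ^ S k * Cmod h ^ 2).
      { apply Rmult_le_compat_r; [exact Hh|]. apply Rmult_le_compat_l; assumption. }
      rewrite (S_INR (S (S k))).
      set (N := INR (S (S k))) in *.
      assert (HN : INR (S k) = N - 1) by (unfold N; rewrite (S_INR (S k)); lra).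
      rewrite HN in HE. simpl pow in *.
      assert (0 <= N * x * x ^ k * (Cmod h * (Cmod h * 1))).
      { repeat apply Rmult_le_pos; try assumption; try apply Cmod_ge_0; lra. }
      nra.
    + unfold E. rewrite (S_INR (S (S k))), RtoC_plus. simpl Cpow. ring.
Qed.

Lemma is_derive_of_quadratic_bound (f : C -> C) (z l : C) (M rho : R) :
  0 <= M -> 0 < rho ->
  (forall h, Cmod h < rho -> Cmod (f (z + h) - f z - h * l)%C <= M * Cmod h ^ 2) ->
  @is_derive C_AbsRing C_NormedModule f z l.
Proof.
  intros HM Hrho Hb. split; [apply is_linear_scal_l|].
  intros x Hx.
  apply (is_filter_lim_locally_unique (K := C_AbsRing) (V := AbsRing_NormedModule C_AbsRing)) in Hx. subst x.
  intro eps. apply (locally_le_locally_norm (K := C_AbsRing) (V := AbsRing_NormedModule C_AbsRing)).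
  assert (Hd : 0 < Rmin rho (eps / (M + 1))).
  { apply Rmin_pos; [exact Hrho|]. apply Rdiv_lt_0_compat; [apply cond_pos|lra]. }
  exists (mkposreal _ Hd). intro y. change C in y. intro Hy.
  change (Cmod (y - z)%C < Rmin rho (eps / (M + 1))) in Hy.
  change (Cmod (f y - f z - (y - z) * l)%C <= eps * Cmod (y - z)%C).
  assert (Hy1 := Rlt_le_trans _ _ _ Hy (Rmin_l _ _)).
  assert (Hy2 := Rlt_le_trans _ _ _ Hy (Rmin_r _ _)).
  specialize (Hb _ Hy1). replace (z + (y - z))%C with y in Hb by ring.
  eapply Rle_trans; [exact Hb|].
  assert (H0 := Cmod_ge_0 (y - z)%C). set (d := Cmod (y - z)%C) in *.
  assert (d * (M + 1) <= eps).
  { replace (pos eps) with (eps / (M + 1) * (M + 1)) by (field; lra).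
    apply Rmult_le_compat_r; lra. }
  simpl pow. nra.
Qed.

(** The second-order remainders of the monomials sum up to O(h^2), since the
    second derived series of the moduli converges at a radius x strictly
    between |z| and 1. *)
Lemma expansion_derive (f : C -> C) (a : nat -> C) :
  expansion f a ->
  exists f1, expansion f1 (fun k => RtoC (INR (S k)) * a (S k))%C /\
    forall z, in_disc z -> @is_derive C_AbsRing C_NormedModule f z (f1 z).
Proof.
  intro Hf. set (b := fun k => Cmod (a k)).
  set (a1 := fun k => (RtoC (INR (S k)) * a (S k))%C).
  assert (Hex : forall z, in_disc z -> exists l, Cseries (fun k => a1 k * z ^ k)%C l).
  { intros z Hz.
    apply (@ex_series_le C_AbsRing C_CompleteNormedModule _
             (fun k => Rabs (PS_derive b k * Cmod z ^ k))).
    - intro k. change (Cmod (a1 k * z ^ k)%C <= Rabs (PS_derive b k * Cmod z ^ k)).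
      rewrite Cmod_mult, Cmod_pow. unfold a1, PS_derive, b.
      rewrite Cmod_mult, Cmod_R, Rabs_pos_eq by apply pos_INR.
      apply Rle_abs.
    - apply CV_disk_inside. rewrite CV_radius_derive.
      apply (expansion_CV_radius f a); [exact Hf|]. split; [apply Cmod_ge_0|exact Hz]. }
  set (f1 := fun z => epsilon (inhabits (RtoC 0)) (fun l => Cseries (fun k => a1 k * z ^ k)%C l)).
  assert (Hf1 : forall z, in_disc z -> Cseries (fun k => a1 k * z ^ k)%C (f1 z)).
  { intros z Hz. apply (epsilon_spec (inhabits (RtoC 0))), Hex, Hz. }
  exists f1. split.
  { intros z Hz. apply Cpseries_Cseries, Hf1, Hz. }
  intros z Hz.
  set (x := (Cmod z + 1) / 2).
  assert (Hz0 := Cmod_ge_0 z). unfold in_disc in Hz.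
  assert (Hx : 0 <= x < 1) by (unfold x; lra).
  set (b2 := PS_derive (PS_derive b)).
  assert (Hex2 : ex_series (fun k => Rabs (b2 k * x ^ k))).
  { apply CV_disk_inside. unfold b2. rewrite !CV_radius_derive.
    apply (expansion_CV_radius f a); assumption. }
  destruct Hex2 as [S2 HS2].
  assert (Hb2 : forall k, Rabs (b2 k * x ^ k) = INR (S (S k)) * INR (S k) * x ^ k * Cmod (a (S (S k)))).
  { intro k. unfold b2, PS_derive, b. rewrite Rabs_pos_eq; [ring|].
    repeat apply Rmult_le_pos; try apply pos_INR; try apply Cmod_ge_0. apply pow_le; lra. }
  apply is_derive_of_quadratic_bound with (Rabs S2) ((1 - Cmod z) / 2); [apply Rabs_pos|lra|].
  intros h Hh.
  assert (Hzh : Cmod (z + h)%C <= x).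
  { eapply Rle_trans; [apply Cmod_triangle|]. unfold x. lra. }
  assert (H1 := proj1 (Cpseries_Cseries _ _ _) (Hf (z + h)%C ltac:(unfold in_disc; lra))).
  assert (H2 := proj1 (Cpseries_Cseries _ _ _) (Hf z Hz)).
  assert (H3 := Hf1 z Hz).
  (* the series h f'(z), reindexed to match the powers in f(z + h) - f(z) *)
  set (t := fun k => match k with O => RtoC 0 | S j => (h * (a1 j * z ^ j))%C end).
  assert (H4 : Cseries t (h * f1 z)%C).
  { apply (is_series_decr_n t 1); [lia|]. simpl pred. rewrite sum_O.
    match goal with |- is_series _ ?y => replace y with (h * f1 z)%C end.
    - apply (is_series_scal (K := C_AbsRing) (V := C_NormedModule)). exact H3.
    - transitivity (h * f1 z + - RtoC 0)%C; [ring|reflexivity]. }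
  assert (H5 := is_series_minus _ _ _ _ (is_series_minus _ _ _ _ H1 H2) H4).
  match type of H5 with is_series ?u _ => set (v := u) in H5 end.
  change (Cseries v (f (z + h) - f z - h * f1 z)%C) in H5.
  (* the remainders of the constant and linear monomials vanish *)
  assert (H6 : Cseries (fun k => v (2 + k)%nat) (f (z + h) - f z - h * f1 z)%C).
  { apply (is_series_incr_n v 2); [lia|]. simpl pred. rewrite sum_Sn, sum_O.
    match goal with |- is_series _ ?y => replace y with (f (z + h) - f z - h * f1 z)%C end; [exact H5|].
    transitivity ((f (z + h) - f z - h * f1 z) +
      ((a 0%nat * 1 - a 0%nat * 1 - 0) +
       (a 1%nat * ((z + h) * 1) - a 1%nat * (z * 1) - h * (RtoC 1 * a 1%nat * 1))))%C;
      [ring|reflexivity]. }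
  apply Rle_trans with (Cmod h ^ 2 * S2).
  2: { rewrite Rmult_comm. apply Rmult_le_compat_r; [apply pow2_ge_0|apply Rle_abs]. }
  apply (Cseries_Cmod_le _ _ (fun k => Cmod h ^ 2 * Rabs (b2 k * x ^ k)) _ H6).
  - apply (is_series_scal (K := R_AbsRing) (V := R_NormedModule)). exact HS2.
  - intro k. rewrite Hb2.
    replace (v (2 + k)%nat) with (a (S (S k)) *
      ((z + h) ^ S (S k) - z ^ S (S k) - RtoC (INR (S (S k))) * z ^ S k * h))%C.
    + rewrite Cmod_mult.
      assert (Hd := Cpow_diff_remainder z h x k ltac:(unfold x; lra) Hzh).
      assert (Ha := Cmod_ge_0 (a (S (S k)))).
      apply (Rmult_le_compat_l _ _ _ Ha) in Hd. lra.
    + transitivity (a (S (S k)) * (z + h) ^ S (S k) - a (S (S k)) * z ^ S (S k)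
         - h * (RtoC (INR (S (S k))) * a (S (S k)) * z ^ S k))%C; [ring|reflexivity].
Qed.

Lemma expansion_C_derive (f : C -> C) (a : nat -> C) :
  expansion f a ->
  expansion (C_derive f) (fun k => RtoC (INR (S k)) * a (S k))%C.
Proof.
  intros Hf. destruct (expansion_derive f a Hf) as [f1 [Hf1 Hd]].
  intros z Hz. rewrite (is_C_derive_unique _ _ _ (Hd z Hz)). exact (Hf1 z Hz).
Qed.

(** * Local expansions of analytic functions *)

Lemma analytic_at_sub_scal (f g : C -> C) (s z0 : C) :
  analytic_at f z0 -> analytic_at g z0 -> analytic_at (fun z => f z - s * g z)%C z0.
Proof.
  intros [c [r [Hr Hf]]] [d [r' [Hr' Hg]]].
  exists (fun k => c k - s * d k)%C, (Rmin r r'). split; [apply Rmin_pos; assumption|].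
  intros z Hz.
  assert (H1 := proj1 (Cpseries_Cseries _ _ _) (Hf z (Rlt_le_trans _ _ _ Hz (Rmin_l _ _)))).
  assert (H2 := proj1 (Cpseries_Cseries _ _ _) (Hg z (Rlt_le_trans _ _ _ Hz (Rmin_r _ _)))).
  apply Cpseries_Cseries.
  assert (H3 := is_series_minus _ _ _ _ H1
                  (is_series_scal (K := C_AbsRing) (V := C_NormedModule) s _ _ H2)).
  revert H3. apply is_series_ext. intro k.
  change (c k * (z - z0) ^ k - s * (d k * (z - z0) ^ k) = (c k - s * d k) * (z - z0) ^ k)%C. ring.
Qed.

Lemma analytic_at_mul_id (f : C -> C) (z0 : C) :
  analytic_at f z0 -> analytic_at (fun z => z * f z)%C z0.
Proof.
  intros [c [r [Hr Hf]]].
  exists (fun k => z0 * c k + match k with O => 0 | S j => c j end)%C, r. split; [exact Hr|].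
  intros z Hz. specialize (Hf z Hz).
  assert (H1 := is_pseries_incr_1 _ _ _ Hf).
  apply Cpseries_Cseries in H1. apply Cpseries_Cseries in Hf.
  apply (is_series_scal (K := C_AbsRing) (V := C_NormedModule) z0) in Hf.
  assert (H3 := is_series_plus _ _ _ _ Hf H1).
  apply Cpseries_Cseries.
  match type of H3 with is_series _ ?l => replace (z * f z)%C with l end.
  - revert H3. apply is_series_ext. intros [|k].
    + change (z0 * (c 0%nat * 1) + 0 * 1 = (z0 * c 0%nat + 0) * 1)%C. ring.
    + change (z0 * (c (S k) * (z - z0) ^ S k) + c k * (z - z0) ^ S k
              = (z0 * c (S k) + c k) * (z - z0) ^ S k)%C. ring.
  - change (z0 * f z + (z - z0) * f z = z * f z)%C. ring.
Qed.

Lemma analytic_at_pow (m : nat) (z0 : C) : analytic_at (fun z => z ^ m)%C z0.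
Proof.
  induction m as [|m IH]; [|exact (analytic_at_mul_id _ _ IH)].
  exists (fun k => match k with O => RtoC 1 | S _ => RtoC 0 end), 1. split; [lra|].
  intros z _. apply Cpseries_Cseries. simpl Cpow.
  apply (is_series_ext (K := C_AbsRing) (V := C_NormedModule)) with
    (fun k => match k with O => RtoC 1 | S _ => RtoC 0 end); [|apply Cseries_head].
  intros [|k].
  - change (RtoC 1 = 1 * 1)%C. ring.
  - change (RtoC 0 = 0 * (z - z0) ^ S k)%C. ring.
Qed.

(** The remainder is big-O of the next power rather than little-o, so that the
    constants combine by plain inequalities. *)
Definition leading_term (f : C -> C) (z0 c : C) (k : nat) : Prop :=
  exists M rho, 0 < M /\ 0 < rho /\ forall z, Cmod (z - z0)%C < rho ->
    Cmod (f z - c * (z - z0) ^ k)%C <= M * Cmod (z - z0)%C ^ S k.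

Lemma leading_term_ext (f g : C -> C) (z0 c : C) (k : nat) :
  (forall z, f z = g z) -> leading_term f z0 c k -> leading_term g z0 c k.
Proof.
  intros Hfg [M [rho [HM [Hrho Hb]]]]. exists M, rho.
  split; [exact HM|]. split; [exact Hrho|]. intros z Hz. rewrite <- Hfg. exact (Hb z Hz).
Qed.

(** Otherwise c (z - z0)^k would be O((z - z0)^(k+1)) near z0. *)
Lemma leading_term_order (f : C -> C) (z0 c : C) (m k : nat) :
  leading_term f z0 (RtoC 0) m -> leading_term f z0 c k -> c <> RtoC 0 -> (m < k)%nat.
Proof.
  intros [M [r [HM [Hr Hb]]]] [M' [r' [HM' [Hr' Hb']]]] Hc.
  destruct (Nat.lt_ge_cases m k) as [Hlt|Hge]; [exact Hlt|exfalso].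
  assert (Hc' := proj1 (Cmod_gt_0 _) Hc).
  set (t := Rmin (Rmin r r') (Rmin 1 (Cmod c / (M + M'))) / 2).
  assert (Ht : 0 < t /\ t < r /\ t < r' /\ t < 1 /\ t * (M + M') < Cmod c).
  { assert (0 < Cmod c / (M + M')) by (apply Rdiv_lt_0_compat; lra).
    assert (H0 : 0 < Rmin (Rmin r r') (Rmin 1 (Cmod c / (M + M'))))
      by (repeat apply Rmin_pos; lra).
    assert (H1 := Rmin_l (Rmin r r') (Rmin 1 (Cmod c / (M + M')))).
    assert (H2 := Rmin_r (Rmin r r') (Rmin 1 (Cmod c / (M + M')))).
    assert (H3 := Rmin_l r r'). assert (H4 := Rmin_r r r').
    assert (H5 := Rmin_l 1 (Cmod c / (M + M'))). assert (H6 := Rmin_r 1 (Cmod c / (M + M'))).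
    unfold t. repeat split; try lra.
    replace (Cmod c) with (Cmod c / (M + M') * (M + M')) at 2 by (field; lra).
    apply Rmult_lt_compat_r; lra. }
  clearbody t. destruct Ht as [Ht0 [Ht1 [Ht2 [Ht3 Ht4]]]].
  specialize (Hb (z0 + RtoC t)%C). specialize (Hb' (z0 + RtoC t)%C).
  replace (z0 + RtoC t - z0)%C with (RtoC t) in Hb, Hb' by ring.
  rewrite Cmod_R, Rabs_pos_eq in Hb, Hb' by lra.
  specialize (Hb Ht1). specialize (Hb' Ht2).
  set (w := f (z0 + RtoC t)%C) in *.
  replace (w - 0 * RtoC t ^ m)%C with w in Hb by ring.
  assert (H7 : Cmod c * t ^ k <= M * t ^ S m + M' * t ^ S k).
  { replace (Cmod c * t ^ k) with (Cmod (w + - (w - c * RtoC t ^ k))%C).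
    - eapply Rle_trans; [apply Cmod_triangle|]. rewrite Cmod_opp. lra.
    - replace (w + - (w - c * RtoC t ^ k))%C with (c * RtoC t ^ k)%C by ring.
      rewrite Cmod_mult, Cmod_pow, Cmod_R, Rabs_pos_eq; lra. }
  assert (H8 : t ^ S m <= t ^ S k).
  { replace (S m) with (S k + (m - k))%nat by lia. rewrite pow_add.
    assert (0 <= t ^ S k) by (apply pow_le; lra).
    assert (t ^ (m - k) <= 1) by (rewrite <- (pow1 (m - k)); apply pow_incr; lra).
    nra. }
  assert (Htk : 0 < t ^ k) by (apply pow_lt; lra).
  apply (Rmult_le_compat_l M) in H8; [|lra].
  assert (H9 : Cmod c * t ^ k <= t * (M + M') * t ^ k) by (simpl pow in *; lra).
  apply Rmult_le_reg_r in H9; lra.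
Qed.

Lemma analytic_at_taylor (f : C -> C) (z0 : C) (c : nat -> C) (r : R) (k : nat) :
  0 < r -> (1 <= k)%nat ->
  (forall z, Cmod (z - z0)%C < r -> Cpseries c (z - z0)%C (f z)) ->
  (forall j, (0 < j < k)%nat -> c j = RtoC 0) ->
  leading_term (fun z => f z - f z0)%C z0 (c k) k.
Proof.
  intros Hr Hk Hf Hc.
  destruct (Cpseries_remainder (fun u => f (z0 + u)%C) c r k Hr Hk) as [M [rho [HM [Hrho Hb]]]].
  { intros u Hu. specialize (Hf (z0 + u)%C).
    replace (z0 + u - z0)%C with u in Hf by ring. auto. }
  { exact Hc. }
  assert (H0 : f z0 = c 0%nat).
  { assert (Hz := Hf z0). replace (z0 - z0)%C with (RtoC 0) in Hz by ring.
    rewrite Cmod_0 in Hz. specialize (Hz Hr). 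
    apply (filterlim_locally_unique (K := C_AbsRing) (V := C_NormedModule) _ _ _ Hz).
    apply (is_pseries_0 (K := C_AbsRing) (V := C_NormedModule)). }
  exists M, rho. split; [exact HM|]. split; [exact Hrho|].
  intros z Hz. specialize (Hb (z - z0)%C Hz).
  replace (z0 + (z - z0))%C with z in Hb by ring. rewrite H0. exact Hb.
Qed.

Lemma analytic_at_lipschitz (f : C -> C) (z0 : C) :
  analytic_at f z0 -> exists L rho, 0 < L /\ 0 < rho /\
    forall z, Cmod (z - z0)%C < rho -> Cmod (f z - f z0)%C <= L * Cmod (z - z0)%C.
Proof.
  intros [c [r [Hr Hf]]].
  destruct (analytic_at_taylor f z0 c r 1 Hr ltac:(lia) Hf ltac:(lia)) as [M [rho [HM [Hrho Hb]]]].
  assert (Hc1 := Cmod_ge_0 (c 1%nat)).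
  exists (M + Cmod (c 1%nat)), (Rmin rho 1). split; [lra|]. split; [apply Rmin_pos; lra|].
  intros z Hz.
  assert (Hz1 := Rlt_le_trans _ _ _ Hz (Rmin_l _ _)).
  assert (Hz2 := Rlt_le_trans _ _ _ Hz (Rmin_r _ _)).
  specialize (Hb z Hz1). assert (H0 := Cmod_ge_0 (z - z0)%C).
  replace (f z - f z0)%C with
    ((f z - f z0 - c 1%nat * (z - z0) ^ 1) + c 1%nat * (z - z0))%C by (simpl; ring).
  eapply Rle_trans; [apply Cmod_triangle|]. rewrite (Cmod_mult (c 1%nat)).
  cbv beta in Hb. simpl Cpow in *. simpl pow in Hb.
  set (d := Cmod (z - z0)%C) in *.
  assert (Hd : d * (d * 1) <= d) by nra.
  apply (Rmult_le_compat_l M) in Hd; lra.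
Qed.

(** Look at the first nonzero coefficient of positive index, if there is one. *)
Lemma analytic_at_dichotomy (f : C -> C) (z0 : C) :
  analytic_at f z0 ->
  (exists rho, 0 < rho /\ forall z, Cmod (z - z0)%C < rho -> f z = f z0) \/
  (exists k c, (1 <= k)%nat /\ c <> RtoC 0 /\
     leading_term (fun z => f z - f z0)%C z0 c k).
Proof.
  intros [c [r [Hr Hf]]].
  destruct (classic (exists k, (1 <= k)%nat /\ c k <> RtoC 0)) as [Hex|Hno].
  - right.
    destruct (Wf_nat.dec_inh_nat_subset_has_unique_least_element
                (fun k => (1 <= k)%nat /\ c k <> RtoC 0)) as [k [[[Hk Hck] Hmin] _]].
    { intro n. apply classic. }
    { exact Hex. }
    exists k, (c k). split; [exact Hk|]. split; [exact Hck|].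
    apply (analytic_at_taylor f z0 c r k Hr Hk Hf).
    { intros j Hj. apply NNPP. intro Hcj. specialize (Hmin j (conj (proj1 Hj) Hcj)). lia. }
  - left. exists r. split; [exact Hr|].
    assert (Hc : forall k, (1 <= k)%nat -> c k = RtoC 0).
    { intros k Hk. apply NNPP. intro H. apply Hno. exists k. auto. }
    intros z Hz. rewrite (Cpseries_constant _ _ _ Hc (Hf z Hz)).
    symmetry. apply (Cpseries_constant _ (z0 - z0)%C _ Hc). apply Hf.
    replace (z0 - z0)%C with (RtoC 0) by ring. rewrite Cmod_0. exact Hr.
Qed.

(** * Increasing the modulus along a root direction *)

Lemma de_moivre (x : R) (k : nat) :
  (((cos x, sin x) : C) ^ k)%C = ((cos (INR k * x), sin (INR k * x)) : C).
Proof.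
  induction k as [|k IH].
  - simpl. rewrite Rmult_0_l, cos_0, sin_0. reflexivity.
  - rewrite S_INR, Rmult_plus_distr_r, Rmult_1_l, cos_plus, sin_plus.
    simpl. rewrite IH. apply injective_projections; simpl; ring.
Qed.

Lemma Cmod_1_polar (w : C) : Cmod w = 1 -> exists x, w = ((cos x, sin x) : C).
Proof.
  destruct w as [u v]. intro Hw.
  assert (H : u ^ 2 + v ^ 2 = 1).
  { assert (Hs := pow2_sqrt (u ^ 2 + v ^ 2)). unfold Cmod in Hw. simpl fst in Hw; simpl snd in Hw.
    rewrite Hw in Hs. rewrite <- Hs; [ring|]. nra. }
  assert (Hu : -1 <= u <= 1) by nra.
  destruct (Rle_dec 0 v) as [Hv|Hv].
  - exists (acos u). rewrite cos_acos, sin_acos by assumption.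
    f_equal. symmetry. apply sqrt_lem_1; [unfold Rsqr; nra|exact Hv|unfold Rsqr; nra].
  - exists (- acos u). rewrite cos_neg, sin_neg, cos_acos, sin_acos by assumption.
    f_equal. rewrite (sqrt_lem_1 _ (- v)); [ring|unfold Rsqr; nra|lra|unfold Rsqr; nra].
Qed.

Lemma Cmod_1_root (w : C) (k : nat) :
  (1 <= k)%nat -> Cmod w = 1 -> exists e : C, Cmod e = 1 /\ (e ^ k)%C = w.
Proof.
  intros Hk Hw. destruct (Cmod_1_polar w Hw) as [x ->].
  exists ((cos (x / INR k), sin (x / INR k)) : C). split.
  - unfold Cmod. simpl fst; simpl snd.
    replace (_ + _) with 1; [apply sqrt_1|].
    rewrite <- (sin2_cos2 (x / INR k)). unfold Rsqr. ring.
  - rewrite de_moivre. replace (INR k * (x / INR k)) with x; [reflexivity|].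
    field. apply not_0_INR. lia.
Qed.

(** Move from z0 by t e, with e chosen so that c (t e)^k = s t^k h0 P(z0) and
    s > 0.  To leading order W is then (1 + s t^k) h0 P, and the errors,
    including that of replacing P(z0) by P(z), are O(t^(k+1)).  Keeping P as
    a factor makes this a statement about the quotient W / P. *)
Lemma exceeds_nearby (W P : C -> C) (z0 h0 c : C) (k : nat) :
  h0 <> RtoC 0 -> P z0 <> RtoC 0 -> c <> RtoC 0 -> (1 <= k)%nat -> analytic_at P z0 ->
  leading_term (fun z => W z - h0 * P z)%C z0 c k ->
  forall eps, 0 < eps ->
    exists z, Cmod (z - z0)%C < eps /\ Cmod h0 * Cmod (P z) < Cmod (W z).
Proof.
  intros Hh0 HP0 Hc Hk HPan [M [r1 [HM [Hr1 HW]]]] eps Heps.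
  destruct (analytic_at_lipschitz P z0 HPan) as [L [r2 [HL [Hr2 HP]]]].
  assert (Hh0' := proj1 (Cmod_gt_0 _) Hh0).
  assert (HP0' := proj1 (Cmod_gt_0 _) HP0).
  assert (Hc' := proj1 (Cmod_gt_0 _) Hc).
  set (H := Cmod h0) in *. set (Q := Cmod (P z0)) in *. set (s := Cmod c / (H * Q)).
  assert (HHQ : 0 < H * Q) by (apply Rmult_lt_0_compat; assumption).
  assert (Hs : 0 < s) by (apply Rdiv_lt_0_compat; assumption).
  assert (Hs0 : RtoC s <> 0%C).
  { intro E. apply RtoC_inj in E. lra. }
  (* with this direction e, c (t e)^k = s t^k h0 P(z0); the constant s makes
     the right-hand side below a unit *)
  destruct (Cmod_1_root (RtoC s * (h0 * P z0) / c)%C k Hk) as [e [He1 Hek]].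
  { rewrite Cmod_div, !Cmod_mult, Cmod_R, Rabs_pos_eq by (assumption || lra).
    fold H Q. unfold s. field. repeat split; apply Rgt_not_eq; assumption. }
  set (A := 2 * s * H * L + M).
  assert (HsHL : 0 <= s * H * L) by (apply Rmult_le_pos; [apply Rmult_le_pos|]; lra).
  assert (HA : 0 <= A) by (unfold A; lra).
  set (b := s * (H * Q)). assert (Hb : 0 < b) by (apply Rmult_lt_0_compat; assumption).
  set (t := Rmin (Rmin (Rmin r1 r2) eps) (b / (A + 1)) / 2).
  assert (Ht : 0 < t /\ t < r1 /\ t < r2 /\ t < eps /\ t * (A + 1) < b).
  { assert (0 < b / (A + 1)) by (apply Rdiv_lt_0_compat; lra).
    assert (Ht0 : 0 < Rmin (Rmin (Rmin r1 r2) eps) (b / (A + 1))) by (repeat apply Rmin_pos; assumption).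
    assert (Ht1 := Rmin_l (Rmin (Rmin r1 r2) eps) (b / (A + 1))).
    assert (Ht2 := Rmin_r (Rmin (Rmin r1 r2) eps) (b / (A + 1))).
    assert (Ht3 := Rmin_l (Rmin r1 r2) eps). assert (Ht4 := Rmin_r (Rmin r1 r2) eps).
    assert (Ht5 := Rmin_l r1 r2). assert (Ht6 := Rmin_r r1 r2).
    unfold t. repeat split; try lra.
    replace b with (b / (A + 1) * (A + 1)) at 2 by (field; lra).
    apply Rmult_lt_compat_r; lra. }
  destruct Ht as [Ht0 [Htr1 [Htr2 [Hte HtA]]]].
  set (z := (z0 + RtoC t * e)%C). exists z.
  assert (Hzz : (z - z0 = RtoC t * e)%C) by (unfold z; ring).
  assert (Hmod : Cmod (z - z0)%C = t).
  { rewrite Hzz, Cmod_mult, He1, Cmod_R, Rabs_pos_eq; lra. }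
  split; [lra|].
  specialize (HW z). specialize (HP z). rewrite Hmod in HW, HP.
  specialize (HW Htr1). specialize (HP Htr2).
  assert (Hlead : (c * (z - z0) ^ k = RtoC (t ^ k * s) * (h0 * P z0))%C).
  { rewrite Hzz, Cpow_mult_l, Hek, <- RtoC_pow, RtoC_mult. field. exact Hc. }
  rewrite Hlead in HW.
  set (R0 := (W z - h0 * P z - RtoC (t ^ k * s) * (h0 * P z0))%C) in *.
  assert (Htk : 0 < t ^ k) by (apply pow_lt; lra).
  set (g := t ^ k * s) in *. assert (Hg : 0 < g) by (apply Rmult_lt_0_compat; lra).
  assert (Hdecomp : (RtoC (1 + g) * (h0 * P z)
            = W z + (RtoC g * (h0 * (P z - P z0)) + - R0))%C).
  { unfold R0. rewrite RtoC_plus. ring. }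
  assert (H1 : (1 + g) * (H * Cmod (P z)) <= Cmod (W z) + (g * (H * (L * t)) + M * t ^ S k)).
  { replace ((1 + g) * (H * Cmod (P z))) with (Cmod (RtoC (1 + g) * (h0 * P z))%C).
    2:{ rewrite !Cmod_mult, Cmod_R, Rabs_pos_eq by lra. reflexivity. }
    rewrite Hdecomp.
    eapply Rle_trans; [apply Cmod_triangle|]. apply Rplus_le_compat_l.
    eapply Rle_trans; [apply Cmod_triangle|]. rewrite Cmod_opp.
    apply Rplus_le_compat; [|exact HW].
    rewrite !Cmod_mult, Cmod_R, Rabs_pos_eq by lra. fold H.
    apply Rmult_le_compat_l; [lra|]. apply Rmult_le_compat_l; [lra|]. exact HP. }
  assert (H2 : Q <= Cmod (P z) + L * t).
  { unfold Q. replace (P z0) with (P z + - (P z - P z0))%C by ring.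
    eapply Rle_trans; [apply Cmod_triangle|]. rewrite Cmod_opp. lra. }
  assert (H3 : g * (H * (Q - L * t)) <= g * (H * Cmod (P z))).
  { apply Rmult_le_compat_l; [lra|]. apply Rmult_le_compat_l; lra. }
  assert (H4 : g * (H * (L * t)) + M * t ^ S k < g * (H * (Q - L * t))).
  { unfold g. simpl pow. apply Rlt_0_minus.
    replace (_ - _) with (t ^ k * (b - t * A)) by (unfold b, A; ring).
    apply Rmult_lt_0_compat; [exact Htk|]. lra. }
  lra.
Qed.

(** * Maxima on compact subsets of the plane *)

Lemma list_has_max {A : Type} (F : A -> R) (l : list A) :
  l <> nil -> exists t, In t l /\ forall s, In s l -> F s <= F t.
Proof.
  induction l as [|x l IH]; [congruence|]. intros _.
  destruct l as [|y l].
  - exists x. split; [left; reflexivity|]. intros s [->|[]]. lra.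
  - destruct IH as [t [Ht Hmax]]; [congruence|].
    destruct (Rle_dec (F x) (F t)) as [Hx|Hx].
    + exists t. split; [right; exact Ht|]. intros s [->|Hs]; [exact Hx|auto].
    + exists x. split; [left; reflexivity|].
      intros s [->|Hs]; [lra|]. specialize (Hmax s Hs). lra.
Qed.

(** Otherwise each point z of K has a point g of K where F is larger, and by
    semicontinuity F < F(g) on K near z.  Finitely many such neighbourhoods
    cover K; the largest of the corresponding values F(g) is then exceeded by
    another one of them. *)
Lemma usc_attains_max (K : C -> Prop) (F : C -> R) (b : R) :
  (exists z, K z) -> (forall z, K z -> Cmod z <= b) ->
  (forall z, ~ K z -> exists d, 0 < d /\ forall w, Cmod (w - z)%C < d -> ~ K w) ->
  (forall z v, K z -> F z < v ->
     exists d, 0 < d /\ forall w, K w -> Cmod (w - z)%C < d -> F w < v) ->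
  exists z, K z /\ forall w, K w -> F w <= F z.
Proof.
  intros [k0 Hk0] Hb Hcl Husc. apply NNPP. intro Hno.
  assert (Hup : forall z, K z -> exists g, K g /\ F z < F g).
  { intros z Hz. apply NNPP. intro Hn. apply Hno. exists z. split; [exact Hz|].
    intros w Hw. apply Rnot_lt_le. intro. apply Hn. exists w. split; assumption. }
  assert (Hloc : forall z : C, exists dg : posreal * C, K (snd dg) /\
      forall w, K w -> Cmod (w - z)%C < 2 * fst dg -> F w < F (snd dg)).
  { intro z. destruct (classic (K z)) as [Hz|Hz].
    - destruct (Hup z Hz) as [g [Hg Hlt]].
      destruct (Husc z _ Hz Hlt) as [d [Hd Hd']].
      assert (Hd2 : 0 < d / 2) by lra.
      exists (mkposreal _ Hd2, g). split; [exact Hg|].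
      intros w Hw Hwz. apply Hd'; [exact Hw|]. simpl in Hwz. lra.
    - destruct (Hcl z Hz) as [d [Hd Hd']].
      assert (Hd2 : 0 < d / 2) by lra.
      exists (mkposreal _ Hd2, k0). split; [exact Hk0|].
      intros w Hw Hwz. exfalso. apply (Hd' w); [|exact Hw]. simpl in Hwz. lra. }
  set (dg := fun z => proj1_sig (constructive_indefinite_description _ (Hloc z))).
  assert (Hdg : forall z, K (snd (dg z)) /\
      forall w, K w -> Cmod (w - z)%C < 2 * fst (dg z) -> F w < F (snd (dg z))).
  { intro z. exact (proj2_sig (constructive_indefinite_description _ (Hloc z))). }
  set (pt := fun t : Compactness.Tn 2 R => ((fst t, fst (snd t)) : C)).
  apply (compactness_list 2 (- b, (- b, tt)) (b, (b, tt)) (fun t => fst (dg (pt t)))).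
  intros [l Hl].
  assert (Hcov : forall w, K w -> exists t, In t l /\ F w < F (snd (dg (pt t)))).
  { intros w Hw. assert (Hwb := Hb w Hw). assert (Hm := Rmax_Cmod w).
    assert (Hm1 := Rmax_l (Rabs (fst w)) (Rabs (snd w))).
    assert (Hm2 := Rmax_r (Rabs (fst w)) (Rabs (snd w))).
    destruct (Hl (fst w, (snd w, tt))) as [t [Ht [_ Hclose]]].
    { simpl. split; [|split; [|exact I]]; apply Rabs_le_between; lra. }
    exists t. split; [exact Ht|]. apply (Hdg (pt t)); [exact Hw|].
    destruct t as [t1 [t2 []]]. simpl in Hclose. destruct Hclose as [Hc1 [Hc2 _]].
    (* the cover is by squares of half-side delta, each inside the disc of
       radius 2 delta as sqrt 2 < 2 *)
    eapply Rle_lt_trans; [apply Cmod_2Rmax|].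
    change (fst (w - pt (t1, (t2, tt)))%C) with (fst w - t1).
    change (snd (w - pt (t1, (t2, tt)))%C) with (snd w - t2).
    assert (Hmax := Rmax_lub_lt _ _ _ Hc1 Hc2).
    assert (Hs0 := sqrt_pos 2).
    assert (Hs2 : sqrt 2 < 2).
    { apply Rsqr_incrst_0; [|apply sqrt_pos|lra]. rewrite Rsqr_sqrt by lra. unfold Rsqr. lra. }
    assert (0 <= Rmax (Rabs (fst w - t1)) (Rabs (snd w - t2))).
    { eapply Rle_trans; [apply Rabs_pos|apply Rmax_l]. }
    set (m := Rmax (Rabs (fst w - t1)) (Rabs (snd w - t2))) in *.
    assert (sqrt 2 * m <= 2 * m) by (apply Rmult_le_compat_r; lra).
    apply Rle_lt_trans with (2 * m); [assumption|].
    apply Rmult_lt_compat_l; [lra|exact Hmax]. }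
  destruct (list_has_max (fun t => F (snd (dg (pt t)))) l) as [t [Ht Hmax]].
  { destruct (Hcov k0 Hk0) as [t [Ht _]]. intros ->. exact Ht. }
  destruct (Hcov _ (proj1 (Hdg (pt t)))) as [s [Hs Hlt]].
  specialize (Hmax s Hs). lra.
Qed.

(** * A Schwarz lemma for the leading coefficient *)

(** When f has leading term p z^m at the origin, p is the value that removes
    the singularity there. *)
Definition monomial_quotient (f : C -> C) (p : C) (m : nat) (z : C) : C :=
  if Ceq_dec z (RtoC 0) then p else (f z / z ^ m)%C.

Lemma monomial_quotient_0 (f : C -> C) (p : C) (m : nat) :
  monomial_quotient f p m (RtoC 0) = p.
Proof. unfold monomial_quotient. destruct (Ceq_dec _ _); congruence. Qed.

Lemma monomial_quotient_mul (f : C -> C) (p : C) (m : nat) (z : C) :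
  z <> RtoC 0 -> (monomial_quotient f p m z * z ^ m)%C = f z.
Proof.
  intro Hz. unfold monomial_quotient. destruct (Ceq_dec z (RtoC 0)); [congruence|].
  field. apply Cpow_nz, Hz.
Qed.

Lemma monomial_quotient_leading_term (f : C -> C) (p c : C) (m k : nat) :
  (1 <= k)%nat ->
  leading_term (fun z => f z - p * z ^ m)%C (RtoC 0) c (m + k) ->
  leading_term (fun z => monomial_quotient f p m z - p)%C (RtoC 0) c k.
Proof.
  intros Hk [M [rho [HM [Hrho Hb]]]]. exists M, rho. split; [exact HM|]. split; [exact Hrho|].
  intros z Hz. specialize (Hb z Hz).
  replace (z - 0)%C with z in * by ring.
  destruct (Ceq_dec z (RtoC 0)) as [->|Hnz].
  - rewrite monomial_quotient_0, Cmod_0. destruct k as [|k]; [lia|].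
    replace (p - p - c * 0 ^ S k)%C with (RtoC 0) by (simpl; ring).
    rewrite Cmod_0. simpl. lra.
  - rewrite <- (monomial_quotient_mul f p m z Hnz), Cpow_add_r in Hb.
    set (h := monomial_quotient f p m z) in *.
    replace (h * z ^ m - p * z ^ m - c * (z ^ m * z ^ k))%C
      with ((h - p - c * z ^ k) * z ^ m)%C in Hb by ring.
    rewrite Cmod_mult, Cmod_pow in Hb.
    replace (S (m + k)) with (S k + m)%nat in Hb by lia.
    rewrite pow_add, <- Rmult_assoc in Hb.
    apply Rmult_le_reg_r with (Cmod z ^ m); [apply pow_lt, Cmod_gt_0, Hnz|]. exact Hb.
Qed.

(** Away from the origin, |f(z)| - v |z|^m is continuous and negative at z0;
    at the origin, the leading term of f is used. *)
Lemma monomial_quotient_usc (f : C -> C) (p : C) (m : nat) (z0 : C) (v : R) :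
  analytic_at f z0 -> leading_term f (RtoC 0) p m ->
  Cmod (monomial_quotient f p m z0) < v ->
  exists d, 0 < d /\ forall z, Cmod (z - z0)%C < d -> Cmod (monomial_quotient f p m z) < v.
Proof.
  intros Hf Hlead Hv. set (h := monomial_quotient f p m) in *.
  assert (Hh0 := Cmod_ge_0 (h z0)).
  destruct (Ceq_dec z0 (RtoC 0)) as [->|Hnz].
  - unfold h in Hv, Hh0. rewrite monomial_quotient_0 in Hv, Hh0.
    destruct Hlead as [M [rho [HM [Hrho Hb]]]].
    exists (Rmin rho ((v - Cmod p) / M)). split.
    { apply Rmin_pos; [exact Hrho|]. apply Rdiv_lt_0_compat; lra. }
    intros z Hz. destruct (Ceq_dec z (RtoC 0)) as [->|Hnz].
    { unfold h. rewrite monomial_quotient_0. exact Hv. }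
    assert (Hz1 := Rlt_le_trans _ _ _ Hz (Rmin_l _ _)).
    assert (Hz2 := Rlt_le_trans _ _ _ Hz (Rmin_r _ _)).
    specialize (Hb z Hz1). replace (z - 0)%C with z in * by ring.
    apply (Rmult_lt_compat_l M) in Hz2; [|lra].
    replace (M * ((v - Cmod p) / M)) with (v - Cmod p) in Hz2 by (field; lra).
    assert (Hpos : 0 < Cmod z ^ m) by (apply pow_lt, Cmod_gt_0, Hnz).
    apply Rmult_lt_reg_r with (Cmod z ^ m); [exact Hpos|].
    rewrite <- (Cmod_pow z) at 1. rewrite <- Cmod_mult. unfold h.
    rewrite monomial_quotient_mul by exact Hnz.
    replace (f z) with ((f z - p * z ^ m) + p * z ^ m)%C by ring.
    eapply Rle_lt_trans; [apply Cmod_triangle|]. rewrite (Cmod_mult p), Cmod_pow.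
    simpl pow in Hb. nra.
  - destruct (analytic_at_lipschitz f z0 Hf) as [L [r [HL [Hr Hb]]]].
    destruct (analytic_at_lipschitz _ z0 (analytic_at_pow m z0)) as [L' [r' [HL' [Hr' Hb']]]].
    assert (Hz0' := proj1 (Cmod_gt_0 _) Hnz).
    set (gap := v * Cmod z0 ^ m - Cmod (f z0)).
    assert (Hgap : 0 < gap).
    { unfold gap. rewrite <- (monomial_quotient_mul f p m z0 Hnz), Cmod_mult, Cmod_pow. fold h.
      assert (0 < Cmod z0 ^ m) by (apply pow_lt; lra). nra. }
    assert (HD : 0 < L + v * L') by nra.
    exists (Rmin (Rmin r r') (Rmin (Cmod z0) (gap / (L + v * L')))). split.
    { repeat apply Rmin_pos; try assumption. apply Rdiv_lt_0_compat; assumption. }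
    intros z Hz.
    assert (Hza := Rlt_le_trans _ _ _ Hz (Rmin_l _ _)).
    assert (Hzb := Rlt_le_trans _ _ _ Hz (Rmin_r _ _)).
    assert (Hz1 := Rlt_le_trans _ _ _ Hza (Rmin_l _ _)).
    assert (Hz2 := Rlt_le_trans _ _ _ Hza (Rmin_r _ _)).
    assert (Hz3 := Rlt_le_trans _ _ _ Hzb (Rmin_l _ _)).
    assert (Hz4 := Rlt_le_trans _ _ _ Hzb (Rmin_r _ _)).
    specialize (Hb z Hz1). specialize (Hb' z Hz2).
    apply (Rmult_lt_compat_l (L + v * L')) in Hz4; [|lra].
    replace ((L + v * L') * (gap / (L + v * L'))) with gap in Hz4 by (field; lra).
    assert (Hz' : z <> RtoC 0).
    { intros ->. replace (RtoC 0 - z0)%C with (- z0)%C in Hz3 by ring.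
      rewrite Cmod_opp in Hz3. lra. }
    assert (Ho : Cmod (f z) <= Cmod (f z - f z0)%C + Cmod (f z0)).
    { replace (f z) with ((f z - f z0) + f z0)%C at 1 by ring. apply Cmod_triangle. }
    assert (Hp : Cmod z0 ^ m <= Cmod z ^ m + Cmod (z ^ m - z0 ^ m)%C).
    { rewrite <- !Cmod_pow. replace (z0 ^ m)%C with (z ^ m + - (z ^ m - z0 ^ m))%C at 1 by ring.
      eapply Rle_trans; [apply Cmod_triangle|]. rewrite Cmod_opp. lra. }
    apply Rmult_lt_reg_r with (Cmod z ^ m); [apply pow_lt, Cmod_gt_0, Hz'|].
    rewrite <- (Cmod_pow z) at 1. rewrite <- Cmod_mult. unfold h.
    rewrite monomial_quotient_mul by exact Hz'.
    set (d := Cmod (z - z0)%C) in *. unfold gap in Hz4.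
    assert (v * Cmod z0 ^ m <= v * (Cmod z ^ m + L' * d)).
    { apply Rmult_le_compat_l; lra. }
    lra.
Qed.

(** The first alternative is that f is locally h(z0) z^m; otherwise
    exceeds_nearby applies.  Away from the origin it compares f with z^m.  At
    the origin z^m vanishes, and h itself is compared with 1: there f - p z^m
    is of order greater than m, so that dividing by z^m still leaves a positive
    order. *)
Lemma monomial_quotient_max_modulus (f : C -> C) (p : C) (m : nat) (z0 : C) :
  analytic_at f z0 -> leading_term f (RtoC 0) p m ->
  monomial_quotient f p m z0 <> RtoC 0 ->
  (exists d, 0 < d /\ forall z, Cmod (z - z0)%C < d ->
     Cmod (monomial_quotient f p m z0) <= Cmod (monomial_quotient f p m z)) \/
  (forall eps, 0 < eps -> exists z, Cmod (z - z0)%C < eps /\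
     Cmod (monomial_quotient f p m z0) < Cmod (monomial_quotient f p m z)).
Proof.
  intros Hf Hlead Hh0. set (h := monomial_quotient f p m) in *.
  assert (HW : analytic_at (fun z => f z - h z0 * z ^ m)%C z0).
  { apply (analytic_at_sub_scal f (fun z => z ^ m)%C); [exact Hf | apply analytic_at_pow]. }
  assert (Hmul : forall z, z <> RtoC 0 -> (h z * z ^ m)%C = f z)
    by (apply monomial_quotient_mul).
  assert (HW0 : (f z0 - h z0 * z0 ^ m)%C = RtoC 0).
  { destruct (Ceq_dec z0 (RtoC 0)) as [->|Hnz]; [|rewrite Hmul by exact Hnz; ring].
    unfold h. rewrite monomial_quotient_0.
    destruct Hlead as [M [rho [HM [Hrho Hb]]]]. specialize (Hb (RtoC 0)).
    replace (0 - 0)%C with (RtoC 0) in Hb by ring. rewrite Cmod_0 in Hb.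
    specialize (Hb Hrho). apply Cmod_eq_0, Rle_antisym; [|apply Cmod_ge_0].
    simpl pow in Hb. lra. }
  assert (Hsep : exists r, 0 < r /\ forall z, Cmod (z - z0)%C < r -> z = z0 \/ z <> RtoC 0).
  { destruct (Ceq_dec z0 (RtoC 0)) as [->|Hnz].
    - exists 1. split; [lra|]. intros z _. destruct (Ceq_dec z (RtoC 0)); auto.
    - exists (Cmod z0). split; [apply Cmod_gt_0, Hnz|]. intros z Hz. right. intros ->.
      replace (0 - z0)%C with (- z0)%C in Hz by ring. rewrite Cmod_opp in Hz. lra. }
  destruct Hsep as [r0 [Hr0 Hsep]].
  destruct (analytic_at_dichotomy _ _ HW) as [[rho [Hrho Hc]]|[k [c [Hk [Hc Hlt]]]]];
    cbv beta in *.
  - left. exists (Rmin rho r0). split; [apply Rmin_pos; assumption|]. intros z Hz.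
    assert (Hz1 := Rlt_le_trans _ _ _ Hz (Rmin_l _ _)).
    assert (Hz2 := Rlt_le_trans _ _ _ Hz (Rmin_r _ _)).
    specialize (Hc z Hz1). destruct (Hsep z Hz2) as [->|Hnz]; [lra|].
    right. f_equal. rewrite HW0, <- (Hmul z Hnz) in Hc.
    assert (E : ((h z - h z0) * z ^ m)%C = RtoC 0) by (rewrite <- Hc; ring).
    destruct (Ceq_dec (h z - h z0)%C (RtoC 0)) as [E0|E0].
    + replace (h z) with ((h z - h z0) + h z0)%C by ring. rewrite E0. ring.
    + exfalso. exact (Cmult_neq_0 _ _ E0 (Cpow_nz z m Hnz) E).
  - right. intros eps Heps. destruct (Ceq_dec z0 (RtoC 0)) as [->|Hnz].
    + assert (Hp : h (RtoC 0) = p) by apply monomial_quotient_0. rewrite Hp in *.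
      assert (Hlt' : leading_term (fun z => f z - p * z ^ m)%C (RtoC 0) c k).
      { revert Hlt. apply leading_term_ext. intro z. rewrite HW0. ring. }
      assert (Hmk : (m < k)%nat).
      { refine (leading_term_order _ _ _ _ _ _ Hlt' Hc).
        destruct Hlead as [M [rho [HM [Hrho Hb]]]]. exists M, rho.
        split; [exact HM|]. split; [exact Hrho|]. intros z Hz. specialize (Hb z Hz).
        replace (z - 0)%C with z in * by ring.
        replace (f z - p * z ^ m - 0 * z ^ m)%C with (f z - p * z ^ m)%C by ring. exact Hb. }
      replace k with (m + (k - m))%nat in Hlt' by lia.
      apply monomial_quotient_leading_term in Hlt'; [|lia]. fold h in Hlt'.
      destruct (exceeds_nearby h (fun z => z ^ 0)%C (RtoC 0) p c (k - m))
        with (eps := eps) as [z [Hz Hgt]]; try assumption; try lia.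
      * intro E. apply RtoC_inj in E. lra.
      * apply analytic_at_pow.
      * revert Hlt'. apply leading_term_ext. intro z. simpl. ring.
      * exists z. split; [exact Hz|]. simpl Cpow in Hgt. rewrite Cmod_1, Rmult_1_r in Hgt. exact Hgt.
    + destruct (exceeds_nearby f (fun z => z ^ m)%C z0 (h z0) c k)
        with (eps := Rmin eps r0) as [z [Hz Hgt]]; try assumption.
      * apply Cpow_nz, Hnz.
      * apply analytic_at_pow.
      * revert Hlt. apply leading_term_ext. intro z. rewrite HW0. ring.
      * apply Rmin_pos; assumption.
      * exists z. split; [exact (Rlt_le_trans _ _ _ Hz (Rmin_l _ _))|].
        destruct (Hsep z (Rlt_le_trans _ _ _ Hz (Rmin_r _ _))) as [->|Hnz'].
        { exfalso. rewrite <- (Hmul z0 Hnz), Cmod_mult in Hgt. lra. }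
        rewrite <- (Hmul z Hnz'), Cmod_mult in Hgt.
        apply Rmult_lt_reg_r in Hgt; [exact Hgt|]. apply Cmod_gt_0, Cpow_nz, Hnz'.
Qed.

Lemma Cdist_triangle (z w : C) : Cmod z <= Cmod w + Cmod (z - w)%C.
Proof. replace z with (w + (z - w))%C at 1 by ring. apply Cmod_triangle. Qed.

(** A maximum point of |h| on the closed disc that is farthest from the origin
    must lie on the circle.  Upper semicontinuity of |h| gives both the
    maximum and the closedness of the set of maximum points. *)
Lemma Schwarz_on_subdisc (f : C -> C) (p : C) (m : nat) (r : R) :
  analytic f -> (forall z, in_disc z -> Cmod (f z) <= 1) ->
  leading_term f (RtoC 0) p m -> 0 < r < 1 -> Cmod p * r ^ m <= 1.
Proof.
  intros Hf Hb Hlead Hr. set (h := monomial_quotient f p m).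
  assert (Hdisc : forall z, Cmod z <= r -> in_disc z) by (intros z Hz; unfold in_disc; lra).
  assert (Husc : forall z v, in_disc z -> Cmod (h z) < v ->
     exists d, 0 < d /\ forall w, Cmod (w - z)%C < d -> Cmod (h w) < v).
  { intros z v Hz. apply monomial_quotient_usc; [exact (Hf z Hz)|exact Hlead]. }
  assert (Hcl : forall z, ~ Cmod z <= r ->
     exists d, 0 < d /\ forall w, Cmod (w - z)%C < d -> ~ Cmod w <= r).
  { intros z Hz. exists (Cmod z - r). split; [lra|]. intros w Hw.
    assert (H := Cdist_triangle z w). replace (z - w)%C with (- (w - z))%C in H by ring.
    rewrite Cmod_opp in H. lra. }
  destruct (usc_attains_max (fun z => Cmod z <= r) (fun z => Cmod (h z)) r) as [z1 [Hz1 Hmax]].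
  { exists (RtoC 0). rewrite Cmod_0. lra. }
  { auto. }
  { exact Hcl. }
  { intros z v Hz Hv. destruct (Husc z v (Hdisc z Hz) Hv) as [d [Hd H]].
    exists d. split; [exact Hd|]. intros w _. apply H. }
  set (S0 := Cmod (h z1)) in *.
  (* among the maximum points, take one farthest from the origin *)
  destruct (usc_attains_max (fun z => Cmod z <= r /\ S0 <= Cmod (h z)) Cmod r)
    as [z0 [[Hz0 Hz0S] Hfar]].
  { exists z1. split; [exact Hz1|]. unfold S0. lra. }
  { tauto. }
  { intros z Hz. destruct (Rle_dec (Cmod z) r) as [Hzr|Hzr].
    - destruct (Husc z S0 (Hdisc z Hzr)) as [d [Hd H]].
      { apply Rnot_le_lt. tauto. }
      exists d. split; [exact Hd|]. intros w Hw [_ Hw']. specialize (H w Hw). lra.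
    - destruct (Hcl z Hzr) as [d [Hd H]]. exists d. split; [exact Hd|].
      intros w Hw [Hw' _]. exact (H w Hw Hw'). }
  { intros z v _ Hv. exists (v - Cmod z). split; [lra|]. intros w _ Hw.
    assert (H := Cdist_triangle w z). lra. }
  assert (HS : S0 = Cmod (h z0)) by (apply Rle_antisym; auto).
  assert (HpS : Cmod p <= S0).
  { unfold S0. rewrite <- (monomial_quotient_0 f p m). apply Hmax. rewrite Cmod_0. lra. }
  assert (Hrm : 0 < r ^ m) by (apply pow_lt; lra).
  apply Rle_trans with (S0 * r ^ m); [apply Rmult_le_compat_r; lra|].
  destruct (Ceq_dec (h z0) (RtoC 0)) as [E|Hh0].
  { rewrite HS, E, Cmod_0. lra. }
  assert (Hbd : Cmod z0 = r).
  { apply Rle_antisym; [exact Hz0|]. apply Rnot_lt_le. intro Hin.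
    destruct (monomial_quotient_max_modulus f p m z0 (Hf z0 (Hdisc z0 Hz0)) Hlead Hh0)
      as [[d [Hd Hge]]|Hgt].
    - fold h in Hge. set (t := Rmin d (r - Cmod z0) / 2).
      assert (Ht : 0 < t /\ t < d /\ t < r - Cmod z0).
      { assert (0 < Rmin d (r - Cmod z0)) by (apply Rmin_pos; lra).
        assert (H1 := Rmin_l d (r - Cmod z0)). assert (H2 := Rmin_r d (r - Cmod z0)).
        unfold t. lra. }
      (* step outward from z0 along its ray, in any direction if z0 = 0 *)
      assert (Hout : exists w, Cmod (w - z0)%C = t /\ Cmod w = Cmod z0 + t).
      { destruct (Ceq_dec z0 (RtoC 0)) as [->|Hnz].
        - exists (RtoC t). replace (t - 0)%C with (RtoC t) by ring.
          rewrite Cmod_0, Cmod_R, Rabs_pos_eq; lra.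
        - assert (Hz0' := proj1 (Cmod_gt_0 _) Hnz).
          exists (z0 * RtoC (1 + t / Cmod z0))%C. split.
          + replace (z0 * RtoC (1 + t / Cmod z0) - z0)%C with (z0 * RtoC (t / Cmod z0))%C
              by (rewrite RtoC_plus; ring).
            rewrite Cmod_mult, Cmod_R, Rabs_pos_eq; [field; lra|].
            apply Rdiv_le_0_compat; lra.
          + assert (0 <= t / Cmod z0) by (apply Rdiv_le_0_compat; lra).
            rewrite Cmod_mult, Cmod_R, Rabs_pos_eq by lra. field. lra. }
      destruct Hout as [w [Hw1 Hw2]].
      assert (Hw : Cmod w <= Cmod z0).
      { apply Hfar. split; [lra|]. rewrite HS. apply Hge. lra. }
      lra.
    - fold h in Hgt. destruct (Hgt (r - Cmod z0)) as [w [Hw1 Hw2]]; [lra|].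
      assert (H := Cdist_triangle w z0).
      assert (Hw : Cmod (h w) <= S0) by (apply Hmax; lra). lra. }
  rewrite HS, <- Hbd, <- Cmod_pow, <- Cmod_mult. unfold h.
  rewrite monomial_quotient_mul.
  - apply Hb, Hdisc, Hz0.
  - apply Cmod_gt_0. lra.
Qed.

(** Let r tend to 1.  If |p| > 1, Bernoulli's inequality gives an explicit
    r = 1 - x with |p| r^m > 1. *)
Lemma Schwarz_leading_coefficient (f : C -> C) (p : C) (m : nat) :
  analytic f -> (forall z, in_disc z -> Cmod (f z) <= 1) ->
  leading_term f (RtoC 0) p m -> Cmod p <= 1.
Proof.
  intros Hf Hb Hlead. apply Rnot_lt_le. intro Hp.
  assert (Hm := pos_INR m).
  set (x := (Cmod p - 1) / (Cmod p * (INR m + 1))).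
  assert (Hden : 0 < Cmod p * (INR m + 1)) by (apply Rmult_lt_0_compat; lra).
  assert (Hx0 : 0 < x) by (apply Rdiv_lt_0_compat; lra).
  assert (Hxe : x * (Cmod p * (INR m + 1)) = Cmod p - 1) by (unfold x; field; lra).
  clearbody x. assert (Hx1 : x < 1) by nra.
  assert (H := Schwarz_on_subdisc f p m (1 - x) Hf Hb Hlead ltac:(lra)).
  assert (Hbern : 1 - INR m * x <= (1 - x) ^ m).
  { clear - Hx0 Hx1. induction m as [|m IH]; [simpl; lra|].
    rewrite S_INR. simpl pow. assert (Hm := pos_INR m).
    assert (0 <= INR m * x * x) by (repeat apply Rmult_le_pos; lra).
    apply (Rmult_le_compat_l (1 - x)) in IH; [|lra]. lra. }
  apply (Rmult_le_compat_l (Cmod p)) in Hbern; [|lra]. nra.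
Qed.

(** * The coefficient bound *)

(** From phi(w) - phi(0) = b w + O(w^2) and w = omega(z) tending to 0, first
    w = O(F(z) - phi(0)) = O(z^m); hence the error O(w^2) is O(z^(2m)), which
    is O(z^(m+1)) because m >= 1. *)
Lemma leading_term_of_comp (phi omega F : C -> C) (b D : C) (m : nat) :
  (1 <= m)%nat -> b <> RtoC 0 ->
  leading_term (fun w => phi w - phi (RtoC 0))%C (RtoC 0) b 1 ->
  analytic_at omega (RtoC 0) -> omega (RtoC 0) = RtoC 0 ->
  (forall z, in_disc z -> F z = phi (omega z)) ->
  leading_term (fun z => F z - phi (RtoC 0))%C (RtoC 0) D m ->
  leading_term omega (RtoC 0) (D / b)%C m.
Proof.
  intros Hm Hb [M1 [r1 [HM1 [Hr1 H1]]]] Hom Hom0 HF [M2 [r2 [HM2 [Hr2 H2]]]].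
  destruct (analytic_at_lipschitz omega _ Hom) as [L [r3 [HL [Hr3 H3]]]].
  rewrite Hom0 in H3.
  assert (HB := proj1 (Cmod_gt_0 _) Hb). set (B := Cmod b) in *.
  set (K := 2 / B * (Cmod D + M2)).
  assert (HD := Cmod_ge_0 D).
  assert (HK : 0 < K) by (apply Rmult_lt_0_compat; [apply Rdiv_lt_0_compat|]; lra).
  assert (HK2 : 0 <= M1 * (K * K)) by (apply Rmult_le_pos; [lra|apply Rmult_le_pos; lra]).
  assert (HM1L : 0 < M1 * L) by (apply Rmult_lt_0_compat; lra).
  exists ((M2 + M1 * (K * K)) / B),
    (Rmin (Rmin r2 r3) (Rmin 1 (Rmin (r1 / L) (B / (2 * (M1 * L)))))).
  split; [apply Rdiv_lt_0_compat; lra|].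
  split; [repeat apply Rmin_pos; try lra; apply Rdiv_lt_0_compat; lra|].
  intros z Hz.
  assert (Hza := Rlt_le_trans _ _ _ Hz (Rmin_l _ _)).
  assert (Hzb := Rlt_le_trans _ _ _ Hz (Rmin_r _ _)).
  assert (Hzc := Rlt_le_trans _ _ _ Hzb (Rmin_r _ _)).
  assert (Hz2 := Rlt_le_trans _ _ _ Hza (Rmin_l _ _)).
  assert (Hz3 := Rlt_le_trans _ _ _ Hza (Rmin_r _ _)).
  assert (Hz4 := Rlt_le_trans _ _ _ Hzb (Rmin_l _ _)).
  assert (Hz5 := Rlt_le_trans _ _ _ Hzc (Rmin_l _ _)).
  assert (Hz6 := Rlt_le_trans _ _ _ Hzc (Rmin_r _ _)).
  specialize (H2 z Hz2). specialize (H3 z Hz3). cbv beta in H2.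
  replace (z - 0)%C with z in * by ring.
  replace (omega z - 0)%C with (omega z) in H3 by ring.
  rewrite (HF z Hz4) in H2. set (w := omega z) in *.
  set (d := Cmod z) in *. assert (Hd : 0 <= d) by apply Cmod_ge_0.
  assert (Hw0 := Cmod_ge_0 w).
  assert (Hw1 : Cmod w < r1).
  { apply (Rmult_lt_compat_l L) in Hz5; [|lra].
    replace (L * (r1 / L)) with r1 in Hz5 by (field; lra). lra. }
  assert (Hw2 : M1 * Cmod w <= B / 2).
  { apply (Rmult_lt_compat_l (M1 * L)) in Hz6; [|lra].
    replace (M1 * L * (B / (2 * (M1 * L)))) with (B / 2) in Hz6 by (field; lra).
    apply (Rmult_le_compat_l M1) in H3; lra. }
  specialize (H1 w). replace (w - 0)%C with w in H1 by ring. specialize (H1 Hw1).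
  cbv beta in H1. set (v := (phi w - phi (RtoC 0))%C) in *.
  replace (b * w ^ 1)%C with (b * w)%C in H1 by (simpl; ring). simpl (Cmod w ^ 2) in H1.
  assert (Hdm : 0 <= d ^ m) by (apply pow_le; lra).
  assert (HdS : d ^ S m <= d ^ m) by (simpl pow; nra).
  assert (Hv : Cmod v <= (Cmod D + M2) * d ^ m).
  { replace v with ((v - D * z ^ m) + D * z ^ m)%C by ring.
    eapply Rle_trans; [apply Cmod_triangle|]. rewrite (Cmod_mult D), Cmod_pow. fold d.
    apply (Rmult_le_compat_l M2) in HdS; lra. }
  assert (Hbw : B * Cmod w <= Cmod v + M1 * (Cmod w * (Cmod w * 1))).
  { unfold B. rewrite <- Cmod_mult. replace (b * w)%C with (v + - (v - b * w))%C by ring.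
    eapply Rle_trans; [apply Cmod_triangle|]. rewrite Cmod_opp. lra. }
  (* near 0 the quadratic term takes up at most half of b w *)
  assert (HwK : Cmod w <= K * d ^ m).
  { apply Rmult_le_reg_l with (B / 2); [lra|].
    replace (B / 2 * (K * d ^ m)) with ((Cmod D + M2) * d ^ m) by (unfold K; field; lra). nra. }
  assert (Hww : Cmod w * (Cmod w * 1) <= K * K * d ^ S m).
  { apply Rle_trans with ((K * d ^ m) * (K * d ^ m)).
    - rewrite Rmult_1_r. apply Rmult_le_compat; lra.
    - replace (K * d ^ m * (K * d ^ m)) with (K * K * (d ^ m * d ^ m)) by ring.
      apply Rmult_le_compat_l; [nra|].
      destruct m as [|m]; [lia|].
      assert (d ^ S m <= d).
      { simpl pow. assert (d ^ m <= 1) by (rewrite <- (pow1 m); apply pow_incr; lra). nra. }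
      rewrite <- (tech_pow_Rmult d (S m)). apply Rmult_le_compat_r; lra. }
  apply Rmult_le_reg_l with B; [exact HB|].
  replace (B * ((M2 + M1 * (K * K)) / B * d ^ S m))
    with (M2 * d ^ S m + M1 * (K * K * d ^ S m)) by (field; lra).
  unfold B at 1. rewrite <- Cmod_mult.
  replace (b * (w - D / b * z ^ m))%C with ((v - D * z ^ m) + - (v - b * w))%C
    by (field; exact Hb).
  eapply Rle_trans; [apply Cmod_triangle|]. rewrite Cmod_opp.
  apply (Rmult_le_compat_l M1) in Hww; lra.
Qed.

Lemma expansion_at_0 (f : C -> C) (a : nat -> C) : expansion f a -> f (RtoC 0) = a 0%nat.
Proof.
  intro Hf. assert (H := Hf (RtoC 0)). unfold in_disc in H. rewrite Cmod_0 in H.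
  specialize (H Rlt_0_1).
  apply (filterlim_locally_unique (K := C_AbsRing) (V := C_NormedModule) _ _ _ H).
  apply (is_pseries_0 (K := C_AbsRing) (V := C_NormedModule)).
Qed.

(** The value that div_id takes at 0 is a_1, the constant term of the shifted
    series. *)
Lemma expansion_div_id (f : C -> C) (a : nat -> C) :
  a 0%nat = RtoC 0 -> expansion f a -> expansion (div_id f) (fun k => a (S k)).
Proof.
  intros Ha Hf z Hz. unfold div_id. destruct (Ceq_dec z (RtoC 0)) as [->|Hnz].
  - rewrite (expansion_at_0 _ _ (expansion_C_derive f a Hf)).
    replace (RtoC (INR 1) * a 1%nat)%C with (a 1%nat) by (simpl; ring).
    apply (is_pseries_0 (K := C_AbsRing) (V := C_NormedModule) (fun k => a (S k))).
  - assert (H := is_pseries_decr_1 (K := C_AbsRing) (V := C_NormedModule) a z (/ z)%C (f z)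
                   (Cinv_l z Hnz) (Hf z Hz)).
    rewrite Ha in H.
    match type of H with is_pseries _ _ ?l => replace (f z / z)%C with l; [exact H|] end.
    change (/ z * (f z + - RtoC 0) = f z / z)%C. field. exact Hnz.
Qed.

Lemma expansion_mul_id (f : C -> C) (a : nat -> C) :
  expansion f a ->
  expansion (fun z => z * f z)%C (fun k => match k with O => RtoC 0 | S j => a j end).
Proof.
  intros Hf z Hz. assert (H := is_pseries_incr_1 _ _ _ (Hf z Hz)).
  exact H.
Qed.

(** The three operators multiply a_(k+1) z^k by 1 - lambda, lambda (k+1) and
    delta k (k+1); the sum of these is 1 + k (lambda + (k+1) delta). *)
Lemma expansion_H_operator (f : C -> C) (a : nat -> C) (lambda delta : R) :
  a 0%nat = RtoC 0 -> expansion f a ->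
  expansion (fun z => (1 - lambda) * div_id f z + lambda * C_derive f z
                      + delta * z * C_derive (C_derive f) z)%C
    (fun k => RtoC (1 + INR k * (lambda + INR (S k) * delta)) * a (S k))%C.
Proof.
  intros Ha Hf z Hz.
  assert (H1 := proj1 (Cpseries_Cseries _ _ _) (expansion_div_id f a Ha Hf z Hz)).
  assert (Hf1 := expansion_C_derive f a Hf).
  assert (H2 := proj1 (Cpseries_Cseries _ _ _) (Hf1 z Hz)).
  assert (H3 := proj1 (Cpseries_Cseries _ _ _)
                  (expansion_mul_id _ _ (expansion_C_derive _ _ Hf1) z Hz)).
  apply (is_series_scal (K := C_AbsRing) (V := C_NormedModule) (1 - lambda)%C) in H1.
  apply (is_series_scal (K := C_AbsRing) (V := C_NormedModule) (RtoC lambda)) in H2.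
  apply (is_series_scal (K := C_AbsRing) (V := C_NormedModule) (RtoC delta)) in H3.
  assert (H := is_series_plus _ _ _ _ (is_series_plus _ _ _ _ H1 H2) H3).
  apply Cpseries_Cseries. cbv beta.
  match type of H with is_series ?u _ =>
    apply (is_series_ext (K := C_AbsRing) (V := C_NormedModule)) with u end.
  - intros [|k].
    + change ((1 - lambda) * (a 1%nat * 1) + lambda * (RtoC 1 * a 1%nat * 1) + delta * (0 * 1)
        = RtoC (1 + 0 * (lambda + 1 * delta)) * a 1%nat * 1)%C.
      rewrite Rmult_0_l, Rplus_0_r. ring.
    + change ((1 - lambda) * (a (S (S k)) * z ^ S k)
        + lambda * (RtoC (INR (S (S k))) * a (S (S k)) * z ^ S k)
        + delta * (RtoC (INR (S k)) * (RtoC (INR (S (S k))) * a (S (S k))) * z ^ S k)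
        = RtoC (1 + INR (S k) * (lambda + INR (S (S k)) * delta)) * a (S (S k)) * z ^ S k)%C.
      rewrite (S_INR (S k)).
      repeat (rewrite RtoC_plus || rewrite RtoC_mult). ring.
  - match type of H with is_series _ ?l => replace ((1 - lambda) * div_id f z + lambda * C_derive f z
                      + delta * z * C_derive (C_derive f) z)%C with l; [exact H|] end.
    change ((1 - lambda) * div_id f z + lambda * C_derive f z
      + delta * (z * C_derive (C_derive f) z)
      = (1 - lambda) * div_id f z + lambda * C_derive f z
        + delta * z * C_derive (C_derive f) z)%C. ring.
Qed.

Lemma expansion_leading_term (f : C -> C) (a : nat -> C) (k : nat) :
  (1 <= k)%nat -> expansion f a -> (forall j, (0 < j < k)%nat -> a j = RtoC 0) ->
  leading_term (fun z => f z - f (RtoC 0))%C (RtoC 0) (a k) k.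
Proof.
  intros Hk Hf Ha. apply (analytic_at_taylor f (RtoC 0) a 1 k Rlt_0_1 Hk); [|exact Ha].
  intros z Hz. replace (z - 0)%C with z in * by ring. exact (Hf z Hz).
Qed.

Theorem theorem2p4 :
  forall (tau : C) (lambda delta : R) (phi : C -> C) (B : nat -> R)
         (n : nat) (f : C -> C) (a : nat -> C),
    tau <> RtoC 0 ->
    (1 <= lambda)%R ->
    (0 <= delta <= 1)%R ->
    admissible_phi phi B ->
    (4 <= n)%nat ->
    normalized_expansion f a ->
    class_H tau lambda delta phi f ->
    (forall k : nat, (2 <= k <= n - 1)%nat -> a k = RtoC 0) ->
    (Cmod (a n) <=
       B 1%nat * Cmod tau / (1 + (INR n - 1) * (lambda + INR n * delta)))%R.
Proof.
  intros tau lambda delta phi B n f a Htau Hlambda Hdelta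
    (_ & _ & Hphi0 & _ & _ & Hphi & _ & HB1) Hn (Ha0 & Ha1 & Hf)
    (_ & g & _ & (omega & Homega & Hmaps & Homega0 & Hsub) & _) Ha.
  destruct n as [|m]; [lia|].
  set (A := 1 + INR m * (lambda + INR (S m) * delta)).
  replace (1 + (INR (S m) - 1) * (lambda + INR (S m) * delta)) with A
    by (unfold A; rewrite S_INR; ring).
  assert (HA : 0 < A).
  { unfold A. assert (H1 := pos_INR m). assert (H2 := pos_INR (S m)).
    assert (0 <= INR m * (lambda + INR (S m) * delta)).
    { apply Rmult_le_pos; [exact H1|]. assert (0 <= INR (S m) * delta) by (apply Rmult_le_pos; lra). lra. }
    lra. }
  assert (HS := expansion_H_operator f a lambda delta Ha0 Hf).
  assert (HlS := expansion_leading_term _ _ m ltac:(lia) HS).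
  cbv beta in HlS. fold A in HlS.
  assert (HS0 := expansion_at_0 _ _ HS). cbv beta in HS0. rewrite HS0 in HlS.
  rewrite Ha1 in HlS.
  replace (RtoC (1 + INR 0 * (lambda + INR 1 * delta)) * RtoC 1)%C with (RtoC 1) in HlS
    by (simpl INR; rewrite Rmult_0_l, Rplus_0_r; ring).
  assert (HF : leading_term (fun z => H_expr tau lambda delta f z - phi (RtoC 0))%C (RtoC 0)
                 (RtoC A * a (S m) / tau)%C m).
  { destruct HlS as [M [rho [HM [Hrho Hb]]]].
    { intros j Hj. rewrite Ha by lia. ring. }
    assert (Htau' := proj1 (Cmod_gt_0 _) Htau).
    exists (M / Cmod tau), rho. split; [apply Rdiv_lt_0_compat; assumption|].
    split; [exact Hrho|]. intros z Hz. specialize (Hb z Hz).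
    rewrite Hphi0. unfold H_expr.
    match type of Hb with Cmod ?x <= _ =>
      match goal with |- Cmod ?y <= _ => replace y with (x / tau)%C by (field; exact Htau) end end.
    rewrite Cmod_div by exact Htau. unfold Rdiv.
    rewrite (Rmult_comm M), Rmult_assoc, Rmult_comm. apply Rmult_le_compat_l; [|exact Hb].
    left. apply Rinv_0_lt_compat, Htau'. }
  assert (HB1' : RtoC (B 1%nat) <> RtoC 0) by (intro E; apply RtoC_inj in E; lra).
  assert (Hlphi := expansion_leading_term phi _ 1 ltac:(lia) Hphi ltac:(lia)).
  assert (H0disc : in_disc (RtoC 0)) by (unfold in_disc; rewrite Cmod_0; lra).
  assert (Hlom := leading_term_of_comp phi omega _ _ _ m ltac:(lia) HB1' Hlphi
                    (Homega _ H0disc) Homega0 Hsub HF).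
  assert (Hp := Schwarz_leading_coefficient omega _ m Homega
                  (fun z Hz => Rlt_le _ _ (Hmaps z Hz)) Hlom).
  rewrite !Cmod_div, Cmod_mult, !Cmod_R, !Rabs_pos_eq in Hp by (assumption || lra).
  assert (Htau' := proj1 (Cmod_gt_0 _) Htau).
  apply Rmult_le_reg_r with (A / (Cmod tau * B 1%nat)).
  { apply Rdiv_lt_0_compat; [exact HA|]. apply Rmult_lt_0_compat; assumption. }
  replace (B 1%nat * Cmod tau / A * (A / (Cmod tau * B 1%nat))) with 1 by (field; lra).
  replace (Cmod (a (S m)) * (A / (Cmod tau * B 1%nat)))
    with (A * Cmod (a (S m)) / Cmod tau / B 1%nat) by (field; lra).
  exact Hp.
Qed.
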